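(* Let $A=(a_{ij})$ be an $m\times n$ matrix with entries in $\{0,1\}$, let $I_0\subseteq\{1,\ldots,m\}$ with $|I_0|=k$, and let $c=[c_1,\ldots,c_m]^T$ be the column with $c_i=1$ for $i\in I_0$ and $c_i=0$ for $i\notin I_0$. Let $\nu(c)$ be the number of columns of $A$ equal to $c$. For $I\subseteq\{1,\ldots,m\}$ let $A(I)$ be the number of columns of $A$ having $0$'s in all the rows with index in $I\cap I_0$ and $1$'s in all the rows with index in $I\setminus I_0$. Suppose that $A(I)$ depends only on $|I\cap I_0|$ and $|I\setminus I_0|$, and write $A(I)=A(i_1,i_2)$ where $i_1=|I\cap I_0|$ and $i_2=|I\setminus I_0|$. Then $$\nu(c)=\sum_{i_1=0}^{k}\sum_{i_2=0}^{m-k}(-1)^{i_1+i_2}\binom{k}{i_1}\binom{m-k}{i_2}A(i_1,i_2).$$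
   Context: $m,n$ are positive integers. For $I=\emptyset$, $A(\emptyset)=n$. *)

(* Defs.v *)
From mathcomp Require Import all_boot all_order all_algebra.

Set Implicit Arguments.
Unset Strict Implicit.
Unset Printing Implicit Defensive.

Definition zero_one_mx (m n : nat) (A : 'M[nat]_(m, n)) : Prop :=
  forall i j, A i j = 0 \/ A i j = 1.

Definition indicator_col (m : nat) (I0 : {set 'I_m}) : 'cV[nat]_m :=
  (\col_i (if i \in I0 then 1%N else 0%N))%R.

Definition num_col_eq (m n : nat) (A : 'M[nat]_(m, n)) (c : 'cV[nat]_m) : nat :=
  #|[set j : 'I_n | col j A == c]|.

(* This is the quantity A(I); for I = set0 both conditions are vacuous, so the
   count is n. *)
Definition num_col_pattern (m n : nat) (A : 'M[nat]_(m, n))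
    (I0 I : {set 'I_m}) : nat :=
  #|[set j : 'I_n | [forall i in I :&: I0, A i j == 0]
                 && [forall i in I :\: I0, A i j == 1]]|.

(* Main.v *)
Require Import Defs.
From mathcomp Require Import all_boot all_order all_algebra.

(** With [B j] the set of rows in which column [j] disagrees with [c],
    [A(I)] counts the columns with [I \subset B j], while [nu(c)] counts those
    with [B j] empty. Since [\sum_(I \subset B) (-1)^|I| = (1 - 1)^|B|], we get
    [nu(c) = \sum_I (-1)^|I| A(I)], and it remains to group the sets [I] by the
    cardinals of [I :&: I0] and [I :\: I0]. *)

Import GRing.Theory.

Local Open Scope ring_scope.

(** Group the subsets of [S] by cardinal: exactly ['C(#|S|, i)] of them have [i] elements. *)
Lemma sum_subset_card (R : nmodType) (T : finType) (S : {set T})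
    (g : nat -> R) :
  \sum_(X : {set T} | X \subset S) g #|X|
    = \sum_(0 <= i < #|S|.+1) g i *+ 'C(#|S|, i).
Proof.
rewrite big_mkord.
(* [inord] never takes its default value here, since [X \subset S] bounds [#|X|] by [#|S|]. *)
rewrite (partition_big (fun X : {set T} => inord #|X| : 'I_#|S|.+1) predT) //=.
apply: eq_bigr => i _; rewrite -cards_draws -sumr_const.
apply: eq_big => [X | X /andP[sXS /eqP <-]].
  rewrite inE; case: (boolP (X \subset S)) => //= sXS.
  by rewrite -val_eqE /= inordK // ltnS subset_leq_card.
by rewrite inordK // ltnS subset_leq_card.
Qed.

Lemma sum_subset_sign (R : pzRingType) (T : finType) (B : {set T}) :
  \sum_(X : {set T} | X \subset B) (-1) ^+ #|X| = (B == set0)%:R :> R.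
Proof.
rewrite (sum_subset_card _ _ _ (fun i => (-1 : R) ^+ i)) big_mkord.
(* The indicator of [#|B| = 0] is [0 ^+ #|B|]; the binomial formula applies as [1] and [-1]
   commute. *)
rewrite -cards_eq0 -expr0n -[in RHS](subrr 1) exprDn_comm; last exact: commrN1.
by apply: eq_bigr => i _; rewrite expr1n mul1r.
Qed.

(** Cutting [I] along [S] is a bijection onto such pairs, with union as its inverse. *)
Lemma sum_set_split (R : nmodType) (T : finType) (S : {set T})
    (f : {set T} -> {set T} -> R) :
  \sum_(I : {set T}) f (I :&: S) (I :\: S)
    = \sum_(X : {set T} | X \subset S) \sum_(Y : {set T} | Y \subset ~: S) f X Y.
Proof.
rewrite pair_big /=.
rewrite (reindex_onto (fun I : {set T} => (I :&: S, I :\: S))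
                      (fun p => p.1 :|: p.2)) /=.
  apply: eq_bigl => I.
  by rewrite subsetIr setDE subsetIr -setDE setID eqxx.
move=> [X Y] /= /andP[/setIidPl sXS sYS]; congr pair.
  rewrite setIUl sXS; apply/setUidPl.
  by rewrite (disjoint_setI0 _) ?sub0set // -[S]setCK -subsets_disjoint.
by rewrite setDUl !setDE (setIidPl sYS) -sXS -setIA setICr setI0 set0U.
Qed.

Section Disagreement.

Variables (m n : nat) (A : 'M[nat]_(m, n)) (I0 : {set 'I_m}).

(** Read as a number, [i \notin I0] is the value opposite to the entry of [c] in row [i]. This is
    the value that [num_col_pattern] prescribes on the rows of [I]. *)
Definition disagreement_set (j : 'I_n) : {set 'I_m} :=
  [set i | A i j == (i \notin I0)].

Lemma num_col_patternE (I : {set 'I_m}) :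
  num_col_pattern A I0 I = #|[set j | I \subset disagreement_set j]|.
Proof.
apply: eq_card => j; rewrite !inE.
apply/andP/subsetP => [[/forall_inP h0 /forall_inP h1] i iI | sIB].
  rewrite inE; case: (boolP (i \in I0)) => iI0 /=.
    by apply: h0; rewrite inE iI.
  by apply: h1; rewrite inE iI0.
split; apply/forall_inP => i; rewrite inE => /andP[].
  by move=> /sIB; rewrite inE => /eqP-> ->.
by move=> iI0 /sIB; rewrite inE iI0.
Qed.

Lemma num_col_eqE : zero_one_mx A ->
  num_col_eq A (indicator_col I0) = #|[set j | disagreement_set j == set0]|.
Proof.
move=> A01; apply: eq_card => j; rewrite !inE.
apply/eqP/eqP => [/matrixP cj | /setP B0].
  apply/setP => i; move: (cj i ord0); rewrite !inE !mxE => ->.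
  by case: (i \in I0).
apply/matrixP => i z; move: (B0 i); rewrite !inE !mxE.
(* An entry in {0,1} that is not opposite to that of [c] equals it. *)
by case: (A01 i j) => ->; case: (i \in I0).
Qed.

Lemma num_col_eq_sum_pattern (R : pzRingType) : zero_one_mx A ->
  (num_col_eq A (indicator_col I0))%:R
    = \sum_(I : {set 'I_m}) (-1) ^+ #|I| * (num_col_pattern A I0 I)%:R :> R.
Proof.
have cardE (P : pred 'I_n) : #|[set j | P j]|%:R = \sum_j (P j)%:R :> R.
  rewrite cardsE -sum1_card natr_sum big_mkcond; apply: eq_bigr => j _.
  by rewrite unfold_in; case: (P j).
move=> A01; rewrite num_col_eqE // cardE.
(* Expand each indicator of an empty disagreement set as a signed sum over all [I], so that the sums
   over columns and over [I] can be exchanged. *)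
under eq_bigr => j _ do rewrite -sum_subset_sign big_mkcond.
rewrite exchange_big /=; apply: eq_bigr => I _.
rewrite num_col_patternE cardE mulr_sumr.
by apply: eq_bigr => j _; case: ifP; rewrite ?mulr1 ?mulr0.
Qed.

End Disagreement.

Local Close Scope ring_scope.

Theorem mainTheorem2 (m n k : nat) (m_gt0 : (0 < m)%N) (n_gt0 : (0 < n)%N)
    (A : 'M[nat]_(m, n)) (A01 : zero_one_mx A)
    (I0 : {set 'I_m}) (card_I0 : #|I0| = k)
    (a : nat -> nat -> nat)
    (A_dep : forall I : {set 'I_m},
        num_col_pattern A I0 I = a #|I :&: I0| #|I :\: I0|) :
  ((num_col_eq A (indicator_col I0))%:Z =
     \sum_(0 <= i1 < k.+1) \sum_(0 <= i2 < (m - k).+1)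
        (-1) ^+ (i1 + i2) * ('C(k, i1))%:Z * ('C(m - k, i2))%:Z
          * (a i1 i2)%:Z)%R.
Proof.
pose h i1 i2 : int := ((-1) ^+ (i1 + i2) * (a i1 i2)%:Z)%R.
have card_CI0 : #|~: I0| = m - k by rewrite cardsCs setCK card_ord card_I0.
rewrite -[LHS]natz num_col_eq_sum_pattern //.
(* The sign also depends only on the two cardinals, because they add up to [#|I|]. *)
rewrite (eq_bigr (fun I : {set 'I_m} => h #|I :&: I0| #|I :\: I0|)).
  rewrite (sum_set_split _ _ _ (fun X Y => h #|X| #|Y|)).
  under eq_bigr => X _ do rewrite (sum_subset_card _ _ _ (h #|X|)) card_CI0.
  rewrite (sum_subset_card _ _ _
    (fun i => \sum_(0 <= i2 < (m - k).+1) h i i2 *+ 'C(m - k, i2)))%R card_I0.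
  apply: eq_bigr => i1 _; rewrite -sumrMnl; apply: eq_bigr => i2 _.
  (* The two binomial multiplicities merge into one integer factor. *)
  rewrite -mulrnA -mulr_natr natz PoszM /h -!mulrA; congr (_ * _)%R.
  by rewrite [LHS]mulrC mulrA [X in (X * _)%R = _]mulrC.
by move=> I _; rewrite A_dep /h natz cardsID.
Qed.
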